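(* For every $m\in\mathbb N_0$, the resolvent blocks $\Phi_m$ satisfy, as an identity of matrix-valued formal power series in $\tau$, \[ \Phi_m(\tau)=\Bigl(I_{|\mathscr V_m|}-\tau\mathsf A_m-\tau^2\mathsf B_m\,\Phi_{m+1}(\tau)\,\mathsf C_m\Bigr)^{-1}. \] Consequently, $\Phi_0(\tau)$ is given by an iterated matrix continued fraction whose coefficients (the nonzero entries of the blocks $\mathsf A_m,\mathsf B_m,\mathsf C_m$) are the individual bidiagonal entries of $L_1,\dots,L_p,U_q,\dots,U_1$, i.e. each is $1$ or one of the individual coefficients $\ell_n^{(a)},u_n^{(b)}$.
   Context: Let $p,q\ge1$, $M=p+q$, $d=\gcd(p,q)$, $P=p/d$, $Q=q/d$, $R=P+Q$. Let $L_1,\dots,L_p$ be semi-infinite (indexed by $\mathbb N_0$) lower bidiagonal matrices with $(L_a)_{n,n}=1$, $(L_a)_{n+1,n}=\ell_n^{(a)}\in\mathbb C$, and $U_1,\dots,U_q$ upper bidiagonal with $(U_b)_{n,n}=u_n^{(b)}\in\mathbb C$, $(U_b)_{n,n+1}=1$; all other entries vanish. Height-ordered matrix $\mathscr H$ of the prescribed order $L_1,\dots,L_p,U_q,\dots,U_1$: put $\omega_j=(j-1)Q$ for $1\le j\le p$ and $\omega_{p+b}=(q-b+1)P$ for $1\le b\le q$. Rows and columns are indexed by pairs $(h,j)$ with $h\in\mathbb N_0$, $j\in\{1,\dots,M\}$ and $h-\omega_j\in R\mathbb N_0$, ordered by $h$ and then by $j$; put $n_j(h)=(h-\omega_j)/R$,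 and $j^+=j+1$ for $j<M$, $M^+=1$. The only nonzero entries are $\mathscr H_{(h,j),(h+Q,j^+)}=1$; $\mathscr H_{(h,j),(h-P,j^+)}=\ell^{(j)}_{n_j(h)-1}$ for $1\le j\le p$ and $n_j(h)\ge1$; $\mathscr H_{(h,p+b),(h-P,(p+b)^+)}=u^{(q-b+1)}_{n_{p+b}(h)}$ for $1\le b\le q$. Height blocks: $w=\max(P,Q)$; $\mathscr V_m$ is the finite set of indices $(h,j)$ with $mw\le h<(m+1)w$. Relative to $\mathscr V_0,\mathscr V_1,\dots$ the matrix $\mathscr H$ is block tridiagonal; $\mathsf A_m$, $\mathsf B_m$, $\mathsf C_m$ are its blocks with (rows)$\times$(columns) $\mathscr V_m\times\mathscr V_m$, $\mathscr V_m\times\mathscr V_{m+1}$, $\mathscr V_{m+1}\times\mathscr V_m$, respectively. Let $\mathscr H^{\langle m\rangle}$ be the principal submatrix of $\mathscr H$ on $\bigcup_{k\ge m}\mathscr V_k$, and $\Phi_m(\tau)=\bigl[(I-\tau\mathscr H^{\langle m\rangle})^{-1}\bigr]_{\mathscr V_m\times\mathscr V_m}$, where the inverse is the formal Neumann series in $\tau$ (well defined coefficientwise because each row of $\mathscr H$ has finitely many nonzero entries). *)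

(* Defs.v *)
From HB Require Import structures.
From mathcomp Require Import all_boot all_order all_algebra.
From mathcomp Require Import complex.
From mathcomp Require Import boolp classical_sets functions cardinality fsbigop.
From mathcomp Require Import reals.

Set Implicit Arguments.
Unset Strict Implicit.
Unset Printing Implicit Defensive.

Import GRing.Theory.
Local Open Scope classical_set_scope.
Local Open Scope ring_scope.

Section FormalPowerSeries.
Variable K : fieldType.

(* [F : fps K m n] stands for the formal series \sum_k tau^k F k with matrix
   coefficients; addition and opposite are the pointwise ones of functions. *)
Definition fps (m n : nat) := nat -> 'M[K]_(m, n).

Definition fps_const m n (A : 'M[K]_(m, n)) : fps m n :=
  fun k => if k is 0%N then A else 0.

Definition fps_mul m n r (F : fps m n) (G : fps n r) : fps m r :=
  fun k => \sum_(i < k.+1) F i *m G (k - i)%N.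

(* tau ^ r * F *)
Definition fps_shift (r : nat) m n (F : fps m n) : fps m n :=
  fun k => if (r <= k)%N then F (k - r)%N else 0.

Definition fps_inverse n (F G : fps n n) : Prop :=
  fps_mul F G = fps_const 1%:M /\ fps_mul G F = fps_const 1%:M.

Definition fps_unit n (F : fps n n) : Prop := exists G, fps_inverse F G.

(* As for [invmx], the inverse of a non-invertible series is the series
   itself. *)
Definition fps_inv n (F : fps n n) : fps n n :=
  xget F [set G | fps_inverse F G].

(* Convergence for the tau-adic topology. *)
Definition fps_cvg m n (u : nat -> fps m n) (F : fps m n) : Prop :=
  forall k, exists N0, forall N, (N0 <= N)%N -> u N k = F k.

End FormalPowerSeries.

(* Powers of the matrix [A] with rows and columns restricted to [S], where [T]
   may be infinite. The sums are sums over the finite support of the summand,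
   which is the usual matrix product when the rows of [A] are finitely
   supported. *)
Fixpoint inf_mxpow (K : fieldType) (T : choiceType) (S : set T)
    (A : T -> T -> K) (n : nat) (x y : T) : K :=
  if n is n'.+1 then \sum_(z \in S) A x z * inf_mxpow S A n' z y
  else (x == y)%:R.

Definition lower_bidiag (K : fieldType) (l : nat -> K) (i k : nat) : K :=
  if i == k then 1 else if i == k.+1 then l k else 0.

Definition upper_bidiag (K : fieldType) (v : nat -> K) (i k : nat) : K :=
  if i == k then v i else if k == i.+1 then 1 else 0.

Section HeightMatrix.
Variables (p q : nat).

Definition redP : nat := (p %/ gcdn p q)%N.
Definition redQ : nat := (q %/ gcdn p q)%N.
Definition redR : nat := (redP + redQ)%N.
Definition width : nat := maxn redP redQ.

(* The index (h, j) of the literature, 1 <= j <= p + q, is encoded with the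
   0-based ordinal j - 1; [fintype.split] then separates the rows of the p lower
   factors (a - 1 for L_a) from those of the q upper ones (b - 1 for the row
   p + b). All the pairs live in the type [hidx], the genuine indices being
   those satisfying [is_hidx]. *)
Definition hidx : Type := (nat * 'I_(p + q))%type.

Definition omega (j : 'I_(p + q)) : nat :=
  match fintype.split j with
  | inl a => (a * redQ)%N
  | inr b => ((q - b) * redP)%N
  end.

Definition is_hidx (x : hidx) : bool :=
  (omega x.2 <= x.1)%N && (redR %| x.1 - omega x.2)%N.

Definition hrank (x : hidx) : nat := ((x.1 - omega x.2) %/ redR)%N.

(* Sorted by h, then by j. *)
Definition hblock (m : nat) : seq hidx :=
  [seq x <- [seq (h, j) | h <- iota (m * width) width,
                          j <- enum 'I_(p + q)] | is_hidx x].

Definition hblock_tail (m : nat) : set (nat * 'I_(p + q)) :=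
  \bigcup_(k in [set k : nat | (m <= k)%N]) [set` hblock k].

Variables (K : fieldType) (ell : 'I_p -> nat -> K) (u : 'I_q -> nat -> K).

(* The row p + b carries the coefficients of U_(q - b + 1), whence [rev_ord]. *)
Definition height_mx (x y : hidx) : K :=
  if y.2 != ordS x.2 then 0
  else if y.1 == (x.1 + redQ)%N then 1
  else if (y.1 + redP)%N == x.1 then
    match fintype.split x.2 with
    | inl a => if (0 < hrank x)%N then ell a (hrank x).-1 else 0
    | inr b => u (rev_ord b) (hrank x)
    end
  else 0.

Definition block_of (f : hidx -> hidx -> K) (m k : nat) :
    'M[K]_(size (hblock m), size (hblock k)) :=
  \matrix_(i, j) f (tnth (in_tuple (hblock m)) i) (tnth (in_tuple (hblock k)) j).

Definition blockA (m : nat) := block_of height_mx m m.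
Definition blockB (m : nat) := block_of height_mx m m.+1.
Definition blockC (m : nat) := block_of height_mx m.+1 m.

Definition hfps (m : nat) := fps K (size (hblock m)) (size (hblock m)).

Definition Phi (m : nat) : hfps m :=
  fun n => block_of (inf_mxpow (hblock_tail m) height_mx n) m m.

(* I - tau A_m - tau^2 B_m X C_m *)
Definition cf_denom (m : nat) (X : hfps m.+1) : hfps m :=
  fps_const 1%:M - fps_shift 1 (fps_const (blockA m))
  - fps_shift 2
      (fps_mul (fps_mul (fps_const (blockB m)) X) (fps_const (blockC m))).

(* The levels m, ..., m + N - 1 of the continued fraction, the next level
   m + N being replaced by [X (m + N)]. *)
Fixpoint cfrac (X : forall k, hfps k) (N m : nat) : hfps m :=
  if N is N'.+1 then fps_inv (cf_denom (cfrac X N' m.+1)) else X m.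

Definition cf_convergent (N : nat) : hfps 0 := cfrac (fun k => 0) N 0.

Definition bidiag_entry (x : K) : Prop :=
  (exists a n k, x = lower_bidiag (ell a) n k) \/
  (exists b n k, x = upper_bidiag (u b) n k).

Definition bidiag_coef (x : K) : Prop :=
  [\/ x = 1, exists a n, x = ell a n | exists b n, x = u b n].

Definition mx_bidiag_coefs r s (A : 'M[K]_(r, s)) : Prop :=
  forall i j, A i j != 0 -> bidiag_entry (A i j) /\ bidiag_coef (A i j).

End HeightMatrix.

(* Main.v *)
Require Import Defs.
From HB Require Import structures.
From mathcomp Require Import all_boot all_order all_algebra.
From mathcomp Require Import complex.
From mathcomp Require Import boolp classical_sets functions cardinality fsbigop.
From mathcomp Require Import reals.
From mathcomp Require Import zify.

Import GRing.Theory.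
Local Open Scope ring_scope.

(** The coefficient of [tau ^ n] in [Phi m] is the weighted count of the walks
    of length [n] from [V_m] to [V_m] that stay in [V_m], [V_(m+1)], ...  A step
    of [height_mx] changes the height by at most [width], so it moves to the
    same block or to a neighbouring one ([height_mx_dist]).  Cut a nonempty walk
    at its first return to [V_m] after time 0.  Either its first step stays in
    [V_m], which contributes [A_m], or the walk goes up to [V_(m+1)], walks for
    some time strictly above [V_m], and comes down again, which contributes
    [B_m Phi_(m+1) C_m]; then a walk counted by [Phi m] follows.  With the
    powers of [tau] that record the lengths, this is
    [Phi_m = I + (tau A_m + tau^2 B_m Phi_(m+1) C_m) Phi_m] ([PhiS]), so [Phi_m]
    is a right inverse of the denominator.

    A matrix series with constant term [I] has a two-sided inverse, unique even
    as a right inverse ([fps_mul_eq1], [fps_right_inverseP]), so [Phi_m] is the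
    inverse of the denominator ([Phi_inverse]), and iteration of the identity
    gives the finite continued fractions with tail [Phi_N].

    For the convergence, the tail enters each level with the factor [tau ^ 2]:
    changing the tail at depth [N] does not change the coefficients below
    [tau ^ (2 N)] ([cfrac_eqmod]), so the convergents, whose tail is 0, agree
    with [Phi_0] to that order. *)

(** * Formal power series with matrix coefficients *)

Section FpsTheory.
Set Implicit Arguments.
Unset Strict Implicit.
Unset Printing Implicit Defensive.
Variable K : fieldType.

Lemma fps_mul_rev m n r (F : fps K m n) (G : fps K n r) k :
  fps_mul F G k = \sum_(i < k.+1) F (k - i)%N *m G i.
Proof.
rewrite /fps_mul (reindex_inj rev_ord_inj) /=.
by apply: eq_bigr => i _; rewrite subSS subKn // -ltnS.
Qed.

(** Both sides are the sum of [F i *m G l *m H j] over [i + l + j = k]. *)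
Lemma fps_mulA m n r s (F : fps K m n) (G : fps K n r) (H : fps K r s) :
  fps_mul F (fps_mul G H) = fps_mul (fps_mul F G) H.
Proof.
apply/funext => k; rewrite [RHS]fps_mul_rev {1}/fps_mul.
pose c i j := F i *m G (k - i - j)%N *m H j.
transitivity (\sum_(i < k.+1) \sum_(j < k.+1 | (j <= k - i)%N) c i j).
  apply: eq_bigr => /= i _; rewrite fps_mul_rev mulmx_sumr.
  rewrite (big_ord_narrow_leq (leq_subr _ _)).
  by apply: eq_bigr => j _; rewrite mulmxA.
rewrite (exchange_big_dep predT) //=; apply: eq_bigr => j _.
transitivity (\sum_(i < k.+1 | (i <= k - j)%N) c i j).
  by apply: eq_bigl => i; have := ltn_ord i; have := ltn_ord j; lia.
rewrite (big_ord_narrow_leq (leq_subr _ _)) mulmx_suml.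
by apply: eq_bigr => i _; rewrite /c -!subnDA addnC.
Qed.

Lemma fps_mul_constl m n r (A : 'M[K]_(m, n)) (G : fps K n r) k :
  fps_mul (fps_const A) G k = A *m G k.
Proof.
rewrite /fps_mul big_ord_recl /= subn0 big1 ?addr0 // => i _.
by rewrite mul0mx.
Qed.

Lemma fps_mul_constr m n r (F : fps K m n) (A : 'M[K]_(n, r)) k :
  fps_mul F (fps_const A) k = F k *m A.
Proof.
rewrite fps_mul_rev big_ord_recl /= subn0 big1 ?addr0 // => i _.
by rewrite mulmx0.
Qed.

Lemma fps_mul1 m n (G : fps K m n) : fps_mul (fps_const 1%:M) G = G.
Proof. by apply/funext => k; rewrite fps_mul_constl mul1mx. Qed.

Lemma fps_mulr1 m n (F : fps K m n) : fps_mul F (fps_const 1%:M) = F.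
Proof. by apply/funext => k; rewrite fps_mul_constr mulmx1. Qed.

(** For a series [F] with constant term [1], the equation [F G = 1] is this
    recursion, which determines the coefficients of [G] one after the other. *)
Lemma fps_mul_eq1 n (F G : fps K n n) : F 0%N = 1%:M ->
  fps_mul F G = fps_const 1%:M <->
  G 0%N = 1%:M /\
  forall k, G k.+1 = - \sum_(i < k.+1) F i.+1 *m G (k - i)%N.
Proof.
have mulS k : F 0%N = 1%:M ->
    fps_mul F G k.+1 = G k.+1 + \sum_(i < k.+1) F i.+1 *m G (k - i)%N.
  by move=> F0; rewrite /fps_mul big_ord_recl F0 mul1mx subn0.
have mul0 : F 0%N = 1%:M -> fps_mul F G 0%N = G 0%N.
  by move=> F0; rewrite /fps_mul big_ord1 F0 mul1mx.
move=> F0; split=> [FG|[G0 GS]].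
  split=> [|k]; first by rewrite -mul0 ?FG.
  by apply/eqP; rewrite -addr_eq0 -mulS // FG.
apply/funext => -[|k]; first by rewrite mul0.
by rewrite mulS // GS addNr.
Qed.

(** The first [k + 1] coefficients of the right inverse: the recursion of
    [fps_mul_eq1] calls all the previous values, whence the list. *)
Fixpoint inv_coefs n (F : fps K n n) (k : nat) : seq 'M[K]_n :=
  if k is k'.+1 then
    let s := inv_coefs F k' in
    rcons s (- \sum_(i < k'.+1) F i.+1 *m nth 0 s (k' - i))
  else [:: 1%:M].

Lemma fps_right_inverse n (F : fps K n n) : F 0%N = 1%:M ->
  exists G, fps_mul F G = fps_const 1%:M.
Proof.
move=> F0; exists (fun k => nth 0 (inv_coefs F k) k).
have sz k : size (inv_coefs F k) = k.+1.
  by elim: k => //= k IH; rewrite size_rcons IH.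
have stable d k : nth 0 (inv_coefs F (k + d)) k = nth 0 (inv_coefs F k) k.
  elim: d => [|d IH]; first by rewrite addn0.
  by rewrite addnS /= nth_rcons sz ltnS leq_addr.
apply/fps_mul_eq1 => //; split=> // k.
rewrite /= nth_rcons sz ltnn eqxx; congr (- _); apply: eq_bigr => i _.
by rewrite -[in RHS](stable i (k - i)%N) subnK // -ltnS.
Qed.

(** The right inverse [G] of [F] has itself a right inverse, which must be
    [F]. *)
Lemma fps_right_inverseP n (F G : fps K n n) : F 0%N = 1%:M ->
  fps_mul F G = fps_const 1%:M -> fps_inverse F G.
Proof.
move=> F0 FG; split=> //.
have [G0 _] := (fps_mul_eq1 _ F0).1 FG.
have [H GH] := fps_right_inverse G0.
suff -> : F = H by [].
by rewrite -[LHS]fps_mulr1 -GH fps_mulA FG fps_mul1.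
Qed.

Lemma fps_inverse_uniq n (F G G' : fps K n n) :
  fps_inverse F G -> fps_inverse F G' -> G = G'.
Proof.
by move=> [_ GF] [FG' _]; rewrite -[LHS]fps_mulr1 -FG' fps_mulA GF fps_mul1.
Qed.

Lemma fps_invE n (F G : fps K n n) : fps_inverse F G -> fps_inv F = G.
Proof.
by move=> FG; apply: xget_unique => // G' /fps_inverse_uniq; apply.
Qed.

Lemma fps_mulV n (F : fps K n n) : F 0%N = 1%:M ->
  fps_mul F (fps_inv F) = fps_const 1%:M.
Proof.
move=> F0; have [G FG] := fps_right_inverse F0.
by have /fps_invE-> := fps_right_inverseP F0 FG.
Qed.

(** Congruence modulo [tau ^ r]. *)
Definition fps_eqmod (r : nat) m n (F G : fps K m n) : Prop :=
  forall k, (k < r)%N -> F k = G k.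

Lemma fps_eqmod_inv r n (F G : fps K n n) : F 0%N = 1%:M -> G 0%N = 1%:M ->
  fps_eqmod r F G -> fps_eqmod r (fps_inv F) (fps_inv G).
Proof.
move=> F0 G0 eqFG k.
have [F'0 F'S] := (fps_mul_eq1 _ F0).1 (fps_mulV F0).
have [G'0 G'S] := (fps_mul_eq1 _ G0).1 (fps_mulV G0).
elim/ltn_ind: k => -[|k] IH kr; first by rewrite F'0 G'0.
rewrite F'S G'S; congr (- _); apply: eq_bigr => i _.
by rewrite eqFG ?IH //; have := ltn_ord i; lia.
Qed.

End FpsTheory.

(** * Powers of a row-finite matrix *)

Section FirstReturn.
Set Implicit Arguments.
Unset Strict Implicit.
Variables (K : fieldType) (T : choiceType).
Variables (A : T -> T -> K) (nbr : T -> seq T).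
Hypothesis nbrP : forall x y, A x y != 0 -> y \in nbr x.

Lemma fsum_supp (S : set T) (F : T -> K) (r : seq T) :
  (forall y, F y != 0 -> y \in r) ->
  \sum_(z \in S) F z = \sum_(z <- undup r | z \in S) F z.
Proof.
move=> Fr; rewrite [RHS]bigfs ?undup_uniq => [|//|z _].
  by apply: eq_fsbigl; apply/seteqP; split=> z /=; rewrite inE.
by rewrite mem_undup; apply: contraNeq => /Fr.
Qed.

(* [A] moves between the finite block [V] and the rest [S'] of the state space
   only through the part [V'] of [S']. *)
Variables (V V' : seq T) (S S' : set T).
Hypotheses (V_uniq : uniq V) (V'_uniq : uniq V').
Hypothesis SE : S = ([set` V] `|` S')%classic.
Hypothesis V_S' : forall x, x \in V -> ~ S' x.
Hypothesis V'_S' : forall x, x \in V' -> S' x.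
Hypothesis S'V0 : forall x y, S' x -> y \in V -> x \notin V' -> A x y = 0.
Hypothesis VS'0 : forall x y, x \in V -> S' y -> y \notin V' -> A x y = 0.

Local Notation W := (inf_mxpow S A).
Local Notation W' := (inf_mxpow S' A).

(** Every sum over a possibly infinite set becomes a sum over the same finite
    list, which allows sums to be split and exchanged. *)
Lemma row_mulE (D : set T) x (g : T -> K) :
  \sum_(z \in D) A x z * g z = \sum_(z <- undup (nbr x) | z \in D) A x z * g z.
Proof.
apply: fsum_supp => y; apply: contraNT => yN.
by rewrite (contraNeq (@nbrP x y)) ?mul0r.
Qed.

Lemma inf_mxpowS_split n x y :
  W n.+1 x y = \sum_(c <- V) A x c * W n c y + \sum_(z \in S') A x z * W n z y.
Proof.
rewrite /= row_mulE fsbig_seq // !row_mulE [LHS](bigID (mem V)) /=.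
congr (_ + _).
  apply: eq_bigl => z; rewrite SE in_setU !mem_setE.
  by case: (z \in V); rewrite ?andbF.
apply: eq_bigl => z; rewrite SE in_setU mem_setE.
case: (boolP (z \in V)) => [/V_S' zS'|_]; last by rewrite andbT.
by rewrite andbF; apply/esym/negbTE; rewrite notin_setE.
Qed.

(** A walk that starts above [V] and ends in [V] is cut at its first step into
    [V], taken from some [v] in [V']: before this step it stays in [S'], after
    it it is arbitrary in [S]. *)
Lemma first_return n z y : S' z -> y \in V ->
  W n z y = \sum_(j < n) \sum_(v <- V')
    W' j z v * \sum_(c <- V) A v c * W (n - j.+1)%N c y.
Proof.
move=> + Vy; elim: n z => [|n IH] z S'z.
  rewrite big_ord0 /=; case: eqP => // zy.
  by case: (V_S' Vy); rewrite -zy.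
rewrite inf_mxpowS_split big_ord_recl; congr (_ + _).
  (* [j = 0]: the walk enters [V] at once, which forces [z] to be in [V']. *)
  rewrite subSS subn0 /=; have [zV'|zNV'] := boolP (z \in V').
    rewrite [RHS](bigD1_seq z) //= eqxx mul1r [X in _ + X]big1 ?addr0 // => v.
    by rewrite eq_sym => /negPf->; rewrite mul0r.
  rewrite [LHS]big_seq big1 => [|c cV]; last by rewrite S'V0 ?mul0r.
  rewrite [RHS]big_seq big1 // => v vV'.
  by case: eqP zNV' => [->|_]; rewrite ?vV' ?mul0r.
(* [j > 0]: the walk first moves to some [x] in [S'], where the induction
   hypothesis applies; summation over [x] rebuilds [W' j.+1 z v]. *)
transitivity (\sum_(x <- undup (nbr z) | x \in S') \sum_(j < n) \sum_(v <- V')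
    A z x * (W' j x v * \sum_(c <- V) A v c * W (n - j.+1)%N c y)).
  rewrite row_mulE; apply: eq_bigr => x; rewrite inE => S'x.
  rewrite IH // mulr_sumr; apply: eq_bigr => j _.
  by rewrite mulr_sumr.
rewrite exchange_big; apply: eq_bigr => j _ /=.
rewrite exchange_big; apply: eq_bigr => v _ /=.
rewrite row_mulE mulr_suml; apply: eq_bigr => x _.
by rewrite mulrA subSS.
Qed.

(** The first-return decomposition: [\sum_c A v c * W _ c y] is the descent from
    [V'] to [V] followed by the rest of the walk. *)
Lemma inf_mxpowS_return n x y : x \in V -> y \in V ->
  W n.+1 x y = \sum_(c <- V) A x c * W n c y +
    \sum_(j < n) \sum_(z <- V') A x z * \sum_(v <- V')
      W' j z v * \sum_(c <- V) A v c * W (n - j.+1)%N c y.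
Proof.
move=> Vx Vy; rewrite inf_mxpowS_split; congr (_ + _).
rewrite (fsbigE V') //; last first.
  by move=> z S'z zNV'; rewrite VS'0 ?mul0r.
rewrite exchange_big [RHS]big_seq [LHS]big_seq_cond; apply: eq_big => z.
  by rewrite andb_idr // inE; exact: V'_S'.
move=> /andP[_]; rewrite inE => S'z.
by rewrite first_return // mulr_sumr.
Qed.

End FirstReturn.

(** * Height blocks *)

Section HeightBlocks.
Set Implicit Arguments.
Unset Strict Implicit.
Unset Printing Implicit Defensive.
Variables (K : fieldType) (p q : nat) (ell : 'I_p -> nat -> K).
Variable (u : 'I_q -> nat -> K).

Local Notation T := (nat * 'I_(p + q))%type.
Local Notation w := (width p q).
Local Notation H := (height_mx ell u).
Local Notation V := (hblock p q).
Local Notation tail := (@hblock_tail p q).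

Lemma mem_hblock m (x : T) :
  (x \in (V m : seq T)) = is_hidx x && (m * w <= x.1 < m * w + w)%N.
Proof.
rewrite mem_filter; congr (_ && _).
apply/allpairsP/idP => [[[h j] [/=]]|].
  by rewrite mem_iota => hw _ ->.
by case: x => h j hw; exists (h, j); rewrite mem_iota mem_enum.
Qed.

Lemma hblock_uniq m : uniq (V m : seq T).
Proof.
apply/filter_uniq/allpairs_uniq; rewrite ?iota_uniq ?enum_uniq //.
by move=> [a b] [c d] _ _ /= [-> ->].
Qed.

Lemma hblock_tailS m : tail m = ([set` (V m : seq T)] `|` tail m.+1)%classic.
Proof.
apply/seteqP; split=> x.
  move=> [k /=]; rewrite leq_eqVlt => /orP[/eqP <-|mk] Vx; first by left.
  by right; exists k.
by move=> [Vx|[k /= mk Vx]]; [exists m => /=|exists k => //=; apply: ltnW].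
Qed.

Lemma hblock_tail_ge m (x : T) : tail m x -> (m * w <= x.1)%N.
Proof.
move=> [k /= mk]; rewrite mem_hblock => /and3P[_ + _].
by apply: leq_trans; rewrite leq_mul2r mk orbT.
Qed.

(** With [height_mx_dist], this makes [height_mx] block tridiagonal. *)
Lemma mem_hblock_tail m (x : T) :
  tail m x -> (x.1 < m.+1 * w)%N -> x \in (V m : seq T).
Proof.
rewrite hblock_tailS => -[Vx _ //|/hblock_tail_ge xge].
by rewrite ltnNge xge.
Qed.

Lemma height_mx_neq0 (x y : T) : H x y != 0 ->
  y.2 = ordS x.2 /\ (y.1 = (x.1 + redQ p q)%N \/ (y.1 + redP p q)%N = x.1).
Proof.
rewrite /height_mx; case: ifPn => [|/negPn/eqP->]; first by rewrite eqxx.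
case: ifPn => [/eqP-> _|_]; first by split=> //; left.
by case: ifPn => [/eqP <-|]; [split=> //; right|rewrite eqxx].
Qed.

Lemma height_mx_dist (x y : T) : H x y != 0 ->
  (x.1 <= y.1 + w)%N /\ (y.1 <= x.1 + w)%N.
Proof.
by move=> /height_mx_neq0[_]; rewrite /width; lia.
Qed.

(** The second candidate is spurious when the truncated subtraction bites, which
    is harmless for a list that only has to contain the support of row [x]. *)
Definition height_nbr (x : T) : seq T :=
  [:: ((x.1 + redQ p q)%N, ordS x.2); ((x.1 - redP p q)%N, ordS x.2)].

Lemma height_nbrP (x y : T) : H x y != 0 -> y \in height_nbr x.
Proof.
case: y => h j /height_mx_neq0[/= -> hE]; rewrite !inE !xpair_eqE eqxx !andbT.
by case: hE => [->|<-]; rewrite ?eqxx // addnK eqxx orbT.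
Qed.

Lemma block_ofD f g m k :
  @block_of p q K (fun x y => f x y + g x y) m k =
  block_of f m k + block_of g m k.
Proof. by apply/matrixP => i j; rewrite !mxE. Qed.

Lemma block_of_sum n (f : 'I_n -> T -> T -> K) m k :
  block_of (fun x y => \sum_(i < n) f i x y) m k =
  \sum_(i < n) block_of (f i) m k.
Proof.
apply/matrixP => i j; rewrite !mxE summxE.
by under [RHS]eq_bigr do rewrite mxE.
Qed.

Lemma block_of_mul (f g : T -> T -> K) m k l :
  block_of (fun x y => \sum_(z <- V k) f x z * g z y) m l =
  block_of f m k *m block_of g k l.
Proof.
apply/matrixP => i j; rewrite !mxE big_tnth.
by apply: eq_bigr => z _; rewrite !mxE.
Qed.

Lemma eq_block_of (f g : T -> T -> K) m k :
  (forall x y, x \in V m -> y \in V k -> f x y = g x y) ->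
  block_of f m k = block_of g m k.
Proof. by move=> fg; apply/matrixP => i j; rewrite !mxE fg // mem_tnth. Qed.

Lemma Phi0 m : Phi ell u m 0%N = 1%:M.
Proof.
apply/matrixP => i j; rewrite !mxE /= inj_eq //.
by apply/tuple_uniqP; exact: hblock_uniq.
Qed.

Lemma PhiS m n : Phi ell u m n.+1 = blockA ell u m *m Phi ell u m n +
  \sum_(j < n) blockB ell u m *m (Phi ell u m.+1 j *m
    (blockC ell u m *m Phi ell u m (n - j.+1)%N)).
Proof.
rewrite /Phi /blockA /blockB /blockC.
under eq_bigr do rewrite -!block_of_mul.
rewrite -block_of_mul -block_of_sum -block_ofD; apply: eq_block_of => x y Vx Vy.
apply: (inf_mxpowS_return height_nbrP) => //.
- exact: hblock_uniq.
- exact: hblock_uniq.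
- exact: hblock_tailS.
- move=> z; rewrite mem_hblock => /and3P[_ _ zm] /hblock_tail_ge.
  by rewrite mulSn; lia.
- by move=> z Vz; exists m.+1 => /=.
- move=> z z' tz; rewrite mem_hblock => /and3P[_ _ z'm]; apply: contraNeq.
  move=> /height_mx_dist[zz' _]; apply: mem_hblock_tail => //.
  by rewrite !mulSn; lia.
- move=> z z'; rewrite mem_hblock => /and3P[_ _ zm] tz'; apply: contraNeq.
  move=> /height_mx_dist[_ zz']; apply: mem_hblock_tail => //.
  by rewrite !mulSn; lia.
Qed.

Lemma cf_denom0 m (X : hfps p q K m.+1) : cf_denom ell u X 0%N = 1%:M.
Proof. by rewrite /cf_denom !fctE /fps_shift /= !subr0. Qed.

Lemma cf_denom1 m (X : hfps p q K m.+1) : cf_denom ell u X 1%N =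
  - blockA ell u m.
Proof. by rewrite /cf_denom !fctE /fps_shift /= sub0r subr0. Qed.

Lemma cf_denomSS m (X : hfps p q K m.+1) k :
  cf_denom ell u X k.+2 = - (blockB ell u m *m X k *m blockC ell u m).
Proof.
rewrite /cf_denom !fctE /fps_shift /= !subSS !subn0.
by rewrite fps_mul_constr fps_mul_constl subr0 sub0r.
Qed.

(** [PhiS] is the recursion of [fps_mul_eq1] for the denominator. *)
Lemma Phi_inverse m :
  fps_inverse (cf_denom ell u (Phi ell u m.+1)) (Phi ell u m).
Proof.
apply: fps_right_inverseP (cf_denom0 _) _.
apply/fps_mul_eq1; [exact: cf_denom0|split=> [|k]; first exact: Phi0].
rewrite PhiS big_ord_recl cf_denom1 subn0 opprD mulNmx opprK; congr (_ + _).
rewrite -sumrN; apply: eq_bigr => j _.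
by rewrite cf_denomSS mulNmx opprK !mulmxA.
Qed.

Lemma Phi_cf m : Phi ell u m = fps_inv (cf_denom ell u (Phi ell u m.+1)).
Proof. by rewrite (fps_invE (Phi_inverse m)). Qed.

Lemma Phi_cfrac N m : Phi ell u m = cfrac ell u (Phi ell u) N m.
Proof. by elim: N m => //= N IH m; rewrite -IH -Phi_cf. Qed.

(** The factor [tau ^ 2] in front of the tail gains two orders per level. *)
Lemma cf_denom_eqmod r m (X Y : hfps p q K m.+1) : fps_eqmod r X Y ->
  fps_eqmod r.+2 (cf_denom ell u X) (cf_denom ell u Y).
Proof.
move=> XY [|[|k]] kr; first by rewrite !cf_denom0.
  by rewrite !cf_denom1.
by rewrite !cf_denomSS XY.
Qed.

Lemma cfrac_eqmod X Y N m :
  fps_eqmod N.*2 (cfrac ell u X N m) (cfrac ell u Y N m).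
Proof.
elim: N m => [|N IH] m //=.
by apply: fps_eqmod_inv; rewrite ?cf_denom0 //; apply: cf_denom_eqmod.
Qed.

Lemma cf_convergent_cvg : fps_cvg (cf_convergent ell u) (Phi ell u 0%N).
Proof.
move=> k; exists k.+1 => N kN; rewrite (Phi_cfrac N 0).
by apply: cfrac_eqmod; lia.
Qed.

Lemma height_mx_coef (x y : T) : H x y != 0 -> bidiag_coef ell u (H x y).
Proof.
rewrite /height_mx; case: ifP => _; first by rewrite eqxx.
case: ifP => _; first by constructor 1.
case: ifP => _; last by rewrite eqxx.
case: (fintype.split x.2) => [a|b]; last by constructor 3; eexists; eexists.
by case: ifP => _; rewrite ?eqxx // => _; constructor 2; eexists; eexists.
Qed.

(** The coefficient 1 is the diagonal entry of a lower factor, and there is one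
    as [0 < p]. *)
Lemma bidiag_coef_entry (a : K) : (0 < p)%N -> bidiag_coef ell u a ->
  bidiag_entry ell u a.
Proof.
move=> p0 [->|[b [n ->]]|[b [n ->]]].
- by left; exists (Ordinal p0), 0%N, 0%N; rewrite /lower_bidiag eqxx.
- left; exists b, n.+1, n; rewrite /lower_bidiag eqxx ifN //.
  by rewrite eqn_leq ltnn.
- by right; exists b, n, n; rewrite /upper_bidiag eqxx.
Qed.

Lemma block_bidiag_coefs m k : (0 < p)%N ->
  mx_bidiag_coefs ell u (block_of H m k).
Proof.
move=> p0 i j; rewrite mxE => /height_mx_coef Hc; split=> //.
exact: bidiag_coef_entry.
Qed.

End HeightBlocks.

Theorem theorem3p20 (R : realType) (p q : nat) (hp : (0 < p)%N) (hq : (0 < q)%N)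
    (ell : 'I_p -> nat -> R[i]) (u : 'I_q -> nat -> R[i]) :
  (forall m : nat,
     fps_unit (cf_denom ell u (Phi ell u m.+1)) /\
     Phi ell u m = fps_inv (cf_denom ell u (Phi ell u m.+1))) /\
  (forall N : nat, Phi ell u 0 = cfrac ell u (Phi ell u) N 0) /\
  fps_cvg (cf_convergent ell u) (Phi ell u 0) /\
  (forall m : nat,
     mx_bidiag_coefs ell u (blockA ell u m) /\
     mx_bidiag_coefs ell u (blockB ell u m) /\
     mx_bidiag_coefs ell u (blockC ell u m)).
Proof.
split=> [m|].
  by split; [exists (Phi ell u m); exact: Phi_inverse|exact: Phi_cf].
split=> [N|]; first exact: Phi_cfrac.
split; first exact: cf_convergent_cvg.
by move=> m; split; [|split]; exact: block_bidiag_coefs.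
Qed.
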